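(* Let $(W,S)$ be an arbitrary Coxeter system and let $\omega$ be a finite word in the generators $S$. The $\omega$-sorting order on $W_\omega\subseteq W$ is a supersolvable join-distributive lattice, graded by the usual Coxeter length function $\ell:W\to\mathbb{Z}$.
   Context: Let $\omega=(\omega_1,\dots,\omega_m)$. A subword $\alpha\subseteq\omega$ is identified with its index set $I(\alpha)=\{i_1<\dots<i_k\}\subseteq I(\omega)=\{1,\dots,m\}$, with $\alpha=(\omega_{i_1},\dots,\omega_{i_k})$. For a word $\alpha=(\alpha_1,\dots,\alpha_k)$ write $\langle\alpha\rangle=\alpha_1\cdots\alpha_k\in W$; $\alpha$ is reduced if $k=\ell(\langle\alpha\rangle)$. $W_\omega\subseteq W$ is the set of elements $\langle\alpha\rangle$ for subwords $\alpha\subseteq\omega$. For $A,B\subseteq I(\omega)$, $A\leq_{\mathsf{lex}}B$ means $A=B$ or $\min((A\cup B)\setminus(A\cap B))\in A$. For $u\in W_\omega$, the $\omega$-sorted word $\mathsf{sort}_\omega(u)$ is the subword of $\omega$ whose index set is $\leq_{\mathsf{lex}}$-minimum among index sets of subwords of $\omega$ that are reduced words for $u$. The $\omega$-sorting order on $W_\omega$ is: $u\leq_\omega w$ iff $I(\mathsf{sort}_\omega(u))\subseteq I(\mathsf{sort}_\omega(w))$. A finite lattice is join-distributive if for every element $x$ and every set $Y$ of elements covering $x$ the interval $[x,\bigvee_{y\in Y}y]$ is boolean (isomorphic to the lattice of all subsets of a finite set). A finite lattice $P$ is supersolvable if it has a maximal chain $\mathfrak{m}$ such that for every maximal chain $\mathfrak{c}$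 of $P$ the sublattice generated by $\mathfrak{m}\cup\mathfrak{c}$ is distributive. ''Graded by $\ell$'' means that $\ell$ is the rank function: the minimum has $\ell=0$ and $\ell(w)=\ell(u)+1$ whenever $w$ covers $u$. *)

(* Defs.v *)
From HB Require Import structures.
From mathcomp Require Import all_boot all_order boolp.

Set Implicit Arguments.
Unset Strict Implicit.
Unset Printing Implicit Defensive.

Import Order.TTheory.

(* [(s, false)] stands for the letter s and [(s, true)] for its formal
   inverse. *)
Definition signed_word (S : Type) := seq (S * bool).

(* Words equal in the group presented by <S | R>: the quotient of this
   congruence is the free group on S modulo the normal closure of R. *)
Inductive presented_eq (S : Type) (R : signed_word S -> Prop) :
    signed_word S -> signed_word S -> Prop :=
  | presented_refl a : presented_eq R a a
  | presented_sym a b : presented_eq R a b -> presented_eq R b a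
  | presented_trans b a c :
      presented_eq R a b -> presented_eq R b c -> presented_eq R a c
  | presented_cancel a b s e :
      presented_eq R (a ++ [:: (s, e); (s, ~~ e)] ++ b) (a ++ b)
  | presented_relator a b r : R r -> presented_eq R (a ++ r ++ b) (a ++ b).

Definition signed_eval (W : groupType) (S : Type) (gen : S -> W)
    (a : signed_word S) : W :=
  (\prod_(x <- a) (if x.2 then (gen x.1)^-1 else gen x.1))%g.

Definition has_presentation (W : groupType) (S : Type) (gen : S -> W)
    (R : signed_word S -> Prop) : Prop :=
  (forall w : W, exists a, signed_eval gen a = w) /\
  (forall a b, signed_eval gen a = signed_eval gen b <-> presented_eq R a b).

(* Coxeter matrices take values in {1, 2, ..., oo}; oo is encoded as 0, so
   that the corresponding relator is the empty word. *)
Definition coxeter_relator (S : Type) (m : S -> S -> nat)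
    (r : signed_word S) : Prop :=
  exists s t, r = flatten (nseq (m s t) [:: (s, false); (t, false)]).

Record coxeter_system (W : groupType) (S : Type) := CoxeterSystem {
  cox_gen :> S -> W;
  cox_mat : S -> S -> nat;
  cox_mat_sym : forall s t, cox_mat s t = cox_mat t s;
  cox_mat_diag : forall s t, cox_mat s t = 1 <-> s = t;
  cox_presentation : has_presentation cox_gen (coxeter_relator cox_mat)
}.

Section Words.
Variables (W : groupType) (S : Type) (C : coxeter_system W S).

Definition word_prod (a : seq S) : W := (\prod_(s <- a) C s)%g.

Lemma cox_gen_invol (s : S) : (C s * C s)%g = 1%g.
Proof.
have [_ /(_ [:: (s, false); (s, false)] [::]) [_]] := cox_presentation C.
rewrite /signed_eval !big_cons !big_nil mulg1 /=; apply.
have := @presented_relator _ (coxeter_relator (cox_mat C)) [::] [::]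
  [:: (s, false); (s, false)]; apply; exists s, s.
by rewrite (proj2 (cox_mat_diag C s s) erefl).
Qed.

Lemma word_prod_onto (w : W) :
  exists n, `[< exists2 a, word_prod a = w & size a = n >].
Proof.
have [/(_ w) [a <-] _] := cox_presentation C.
exists (size (map fst a)); apply/asboolP; exists (map fst a) => //.
rewrite /word_prod /signed_eval big_map; apply: eq_bigr => -[s []] //= _.
by apply: (mulgI (C s)); rewrite cox_gen_invol mulgV.
Qed.

Definition cox_length (w : W) : nat := ex_minn (word_prod_onto w).

Definition reduced (a : seq S) : bool := size a == cox_length (word_prod a).

Variables (m : nat) (omega : m.-tuple S).

(* [enum A] is increasing. *)
Definition subword (A : {set 'I_m}) : seq S := [seq tnth omega i | i <- enum A].

Definition subword_prods : seq W :=
  [seq word_prod (subword A) | A : {set 'I_m}].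

Definition W_omega : finType := seq_sub subword_prods.

Definition lex_le (A B : {set 'I_m}) : bool :=
  let D := (A :|: B) :\: (A :&: B) in
  (A == B) ||
  [exists i in D, [forall j in D, (i <= j)%N] && (i \in A)].

Definition reduced_subword_for (u : W) (A : {set 'I_m}) : bool :=
  reduced (subword A) && (word_prod (subword A) == u).

(* The index set of sort_omega(u).  The default value [set0] is never used for
   u in W_omega: by the deletion property such a u has a reduced word among the
   subwords of omega. *)
Definition sort_word (u : W) : {set 'I_m} :=
  odflt set0 [pick A | reduced_subword_for u A &
    [forall B, reduced_subword_for u B ==> lex_le A B]].

Definition sorting_le (u w : W) : bool := sort_word u \subset sort_word w.

End Words.

Section FiniteLattices.
Context {d : Order.disp_t} (L : finTBLatticeType d).
Local Open Scope order_scope.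

Definition covered_by (x y : L) : bool :=
  (x < y) && [forall z, ~~ (x < z < y)].

Definition boolean_interval (x y : L) : Prop :=
  exists (T : finType) (g : {set T} -> L),
    (forall z, x <= z <= y <-> exists A, g A = z) /\
    (forall A B, (g A <= g B) = (A \subset B)).

(* Joining with x only matters for [Y = set0], where it makes the interval
   [x, x] instead of [x, \bot]. *)
Definition join_distributive : Prop :=
  forall (x : L) (Y : {set L}), (forall y, y \in Y -> covered_by x y) ->
    boolean_interval x (x `|` \join_(y in Y) y).

Definition is_chain (X : {set L}) : bool :=
  [forall x in X, forall y in X, x >=< y].

Definition maximal_chain (X : {set L}) : bool := maxset is_chain X.

Definition in_generated_sublattice (X : {set L}) (z : L) : Prop :=
  forall A : {set L}, X \subset A ->
    (forall x y, x \in A -> y \in A -> x `&` y \in A) ->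
    (forall x y, x \in A -> y \in A -> x `|` y \in A) ->
    z \in A.

Definition generates_distributive (X : {set L}) : Prop :=
  forall x y z, in_generated_sublattice X x -> in_generated_sublattice X y ->
    in_generated_sublattice X z -> x `&` (y `|` z) = (x `&` y) `|` (x `&` z).

Definition supersolvable : Prop :=
  exists2 M, maximal_chain M &
    forall X, maximal_chain X -> generates_distributive (M :|: X).

Definition graded_by (rk : L -> nat) : Prop :=
  rk \bot = 0 /\ forall x y, covered_by x y -> rk y = (rk x).+1.

End FiniteLattices.

(* Main.v *)
From HB Require Import structures.
Require Import Defs.
From mathcomp Require Import all_boot all_order boolp.

Set Implicit Arguments.
Unset Strict Implicit.
Unset Printing Implicit Defensive.

(* An index set A is the index set of a sorted word if and only if, for every
   index j (in A or not), the letter s_j is not a left descent of the product of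
   the letters of A lying to the right of j.  These sets contain the empty set
   and satisfy a strong exchange axiom: if A and B are sorted and x is the
   minimum of B \ A, then A + x is sorted.  Indeed, suppose that the criterion
   fails for A + x at j < x, and write p and t for the products of the letters
   of A between j and x and after x.  Then s_j is a descent of w = p s_x t but
   not of z = p t, which w covers in Bruhat order, so z = s_j w by the strong
   exchange property, that is, s_j p s_x = p.  This contradicts the criterion
   for the truncation of A + x after x, which is sorted because, by induction
   on x, the missing elements of A can be added one by one to the truncation of
   B after x.

   Such a set system is closed under union and under truncation.  Joins are
   unions and covers add one element, whence join-distributivity and the
   grading.  The truncations of the largest feasible set T form the chain
   required for supersolvability: with a maximal chain X they generate only
   unions of truncations of members of X and of T, a family closed under union
   and intersection. *)

Import Order.TTheory.

(** * Truncations and one-by-one extension of index sets *)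

Definition below (m : nat) (A : {set 'I_m}) (k : nat) : {set 'I_m} :=
  [set i in A | i < k].

Lemma set_has_min (m : nat) (A : {set 'I_m}) (i : 'I_m) :
  i \in A -> exists2 x : 'I_m, x \in A & forall y : 'I_m, y \in A -> x <= y.
Proof.
by move=> iA; case: (@arg_minnP _ i [in A] (@nat_of_ord m) iA) => x; exists x.
Qed.

(** The elements of [B :\: A] are added in increasing order. [Q] is an arbitrary predicate because
    the lemma also serves inside the proof that sorted sets satisfy the exchange axiom. *)
Lemma union_by_exchange (m : nat) (Q : pred {set 'I_m}) (A B : {set 'I_m}) :
    Q A ->
    (forall (Y : {set 'I_m}) (x : 'I_m), Q Y -> A \subset Y -> x \in B :\: Y ->
      (forall y : 'I_m, y \in B :\: Y -> x <= y) -> Q (x |: Y)) ->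
  Q (A :|: B).
Proof.
move=> QA step; have [n] := ubnP #|B :\: A|.
elim: n => // n IHn in A QA step *; rewrite ltnS => leBA.
have [sBA|/subsetPn[i iB iA]] := boolP (B \subset A).
  by rewrite (setUidPl sBA).
have [|x xBA xmin] := @set_has_min _ (B :\: A) i; first by rewrite inE iA.
have /setDP[xB _] := xBA.
have -> : A :|: B = (x |: A) :|: B.
  by apply/setP=> y; rewrite !inE; case: eqP => // ->; rewrite xB orbT.
apply: IHn; first exact: step xmin.
  move=> Y y QY sxAY; apply: step => //.
  by apply: subset_trans sxAY; apply: subsetUr.
have := cardsD1 x (B :\: A); rewrite xBA add1n setDDl [A :|: _]setUC => e.
by rewrite -ltnS -e.
Qed.

(* Armstrong's supersolvable antimatroids, on the ordered ground set 'I_m. *)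
Record ss_antimatroid (m : nat) := SSAntimatroid {
  feasible_sets :> {set {set 'I_m}};
  feasible0 : set0 \in feasible_sets;
  feasible_exchange : forall (A B : {set 'I_m}) (x : 'I_m),
    A \in feasible_sets -> B \in feasible_sets ->
    x \in B :\: A -> (forall y : 'I_m, y \in B :\: A -> x <= y) ->
    x |: A \in feasible_sets
}.

(** * The lattice of feasible sets of a supersolvable antimatroid *)

Section Antimatroid.
Variables (m : nat) (F : ss_antimatroid m).
Implicit Types (A B : {set 'I_m}) (k : nat).

Lemma feasibleU A B : A \in F -> B \in F -> A :|: B \in F.
Proof.
move=> AF BF; apply: (union_by_exchange (Q := mem F)) => // Y x YF _.
exact: feasible_exchange.
Qed.

Lemma feasible_bigcup (I : Type) (r : seq I) (P : pred I)
    (G : I -> {set 'I_m}) :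
  (forall i, P i -> G i \in F) -> \bigcup_(i <- r | P i) G i \in F.
Proof.
by move=> FG; elim/big_ind: _ => //; [exact: feasible0 | exact: feasibleU].
Qed.

(** Passing from [k] to [k.+1] either changes nothing or adds the element [k], the least element of
    [A] outside [below A k]; the exchange axiom then applies with [A] itself as the second set. *)
Lemma feasible_below A k : A \in F -> below A k \in F.
Proof.
move=> AF; elim: k => [|k IHk].
  suff ->: below A 0 = set0 by apply: feasible0.
  by apply/setP=> i; rewrite !inE andbF.
have [|sA] := boolP (below A k.+1 \subset below A k).
  suff sk : below A k \subset below A k.+1.
    by move=> sk'; rewrite (_ : below A _ = below A k) //; apply/eqP;
       rewrite eqEsubset sk'.
  by apply/subsetP=> i; rewrite !inE => /andP[-> /ltnW].
have /subsetPn[x] := sA; rewrite !inE => /andP[xA lexk].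
rewrite xA /= -leqNgt => lekx.
have xE : x = k :> nat by apply/eqP; rewrite eqn_leq -ltnS lexk.
have -> : below A k.+1 = x |: below A k.
  apply/setP=> i; rewrite !inE ltnS leq_eqVlt -xE (val_eqE i x).
  by case: eqP => [->|]; rewrite ?xA.
apply: feasible_exchange AF _ _ => //; first by rewrite !inE xA xE ltnn.
by move=> y; rewrite !inE => /andP[+ yA]; rewrite yA /= -leqNgt xE.
Qed.

(** The largest feasible subset of [A]. It provides meets, since feasible sets need not be closed
    under intersection. *)
Definition interior A : {set 'I_m} := \bigcup_(B in F | B \subset A) B.

Lemma interior_feasible A : interior A \in F.
Proof. by apply: feasible_bigcup => B /andP[]. Qed.

Lemma interior_sub A : interior A \subset A.
Proof. by apply/bigcupsP=> B /andP[]. Qed.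

Lemma sub_interior A B : B \in F -> (B \subset interior A) = (B \subset A).
Proof.
move=> BF; apply/idP/idP => [sB|sBA].
  exact: subset_trans (interior_sub A).
by apply: bigcup_sup; rewrite BF.
Qed.

Definition feasible_lattice : Type := {A : {set 'I_m} | A \in F}.

HB.instance Definition _ := [isSub of feasible_lattice for sval].
HB.instance Definition _ := [Finite of feasible_lattice by <:].

Local Notation L := feasible_lattice.
Implicit Types (x y z : L).

Definition feasible_of A (AF : A \in F) : L := exist _ A AF.

Definition feasible_le x y := val x \subset val y.

Lemma feasible_le_anti : antisymmetric feasible_le.
Proof.
by move=> x y /andP[xy yx]; apply/val_inj/eqP; rewrite eqEsubset; apply/andP.
Qed.

HB.instance Definition _ := Order.Le_isPOrder.Build (Order.Disp tt tt) L
  (fun x => subxx (val x)) feasible_le_anti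
  (fun y x z xy => @subset_trans _ _ _ _ xy).

Lemma feasible_leE x y : (x <= y)%O = (val x \subset val y).
Proof. by []. Qed.

Definition feasible_meet x y : L :=
  feasible_of (interior_feasible (val x :&: val y)).
Definition feasible_join x y : L := feasible_of (feasibleU (valP x) (valP y)).

Lemma feasible_meetP x y z :
  (x <= feasible_meet y z)%O = (x <= y)%O && (x <= z)%O.
Proof. by rewrite -subsetI; apply/sub_interior/valP. Qed.

Lemma feasible_joinP x y z :
  (feasible_join x y <= z)%O = (x <= z)%O && (y <= z)%O.
Proof. by rewrite -subUset. Qed.

HB.instance Definition _ := Order.POrder_MeetJoin_isLattice.Build
  (Order.Disp tt tt) L feasible_meetP feasible_joinP.

Definition feasible_bot : L := feasible_of (feasible0 F).
Definition feasible_top : L := feasible_of (interior_feasible setT).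

HB.instance Definition _ := Order.hasBottom.Build (Order.Disp tt tt) L
  (fun x => sub0set (val x) : (feasible_bot <= x)%O).

Lemma feasible_lex1 x : (x <= feasible_top)%O.
Proof. by rewrite feasible_leE sub_interior ?subsetT //; apply: valP. Qed.

HB.instance Definition _ := Order.hasTop.Build (Order.Disp tt tt) L
  feasible_lex1.

Lemma val_feasible_join x y : val (x `|` y)%O = val x :|: val y.
Proof. by []. Qed.

Lemma val_feasible_bigjoin (I : Type) (r : seq I) (P : pred I) (G : I -> L) :
  val (\join_(i <- r | P i) G i)%O = \bigcup_(i <- r | P i) val (G i).
Proof. by rewrite (big_morph val val_feasible_join (erefl _)). Qed.

Lemma val_feasible_meet x y :
  val x :&: val y \in F -> val (x `&` y)%O = val x :&: val y.
Proof.
by move=> xyF; apply/eqP; rewrite eqEsubset interior_sub sub_interior ?subxx.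
Qed.

(** By exchange, adding to [x] the least element of [y] outside [x] gives a feasible set between the
    two, which must be [y]. *)
Lemma feasible_coveredP x y :
  covered_by x y -> exists2 e, e \notin val x & val y = e |: val x.
Proof.
case/andP=> ltxy /forallP noz.
have [e enx [ey emin]] : exists2 e, e \notin val x & e \in val y /\
    forall i : 'I_m, i \in val y :\: val x -> e <= i.
  have /subsetPn[i iy ix] : ~~ (val y \subset val x).
    by apply: contraTN ltxy => yx; rewrite le_gtF.
  have [|e] := @set_has_min _ (val y :\: val x) i; first by rewrite inE ix.
  by case/setDP=> ey ex emin; exists e.
exists e => //.
have exF : e |: val x \in F.
  by apply: feasible_exchange (valP x) (valP y) _ emin; rewrite inE enx.
pose z := feasible_of exF.
have le_xz : (x <= z)%O by apply: subsetUr.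
have le_zy : (z <= y)%O.
  by rewrite feasible_leE subUset sub1set ey -feasible_leE ltW.
have x'z : x != z.
  by apply: contraNneq enx => ->; rewrite !inE eqxx.
have := noz z; rewrite !lt_neqAle x'z le_xz le_zy /= andbT negbK => /eqP <-.
by [].
Qed.

(** Distinct covers of [x] add distinct single elements, so a join of covers determines which ones
    were used, and a set between [x] and the full join is [x] plus some of these elements. *)
Lemma feasible_join_distributive : join_distributive L.
Proof.
move=> x Y covY; pose T := {y : L | y \in Y}.
pose g (A : {set T}) : L := (x `|` \join_(y in A) val y)%O.
have valg (A : {set T}) : val (g A) = val x :|: \bigcup_(y in A) val (val y).
  by rewrite -val_feasible_bigjoin.
exists T, g; split=> [z|A B]; last first.
  apply/idP/idP => [|sAB]; last first.
    rewrite feasible_leE !valg setUS //; apply/bigcupsP=> y yA.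
    exact: (bigcup_sup y (subsetP sAB y yA)).
  rewrite feasible_leE !valg => sAB.
  apply/subsetP=> y yA.
  have [e enx yE] := feasible_coveredP (covY _ (valP y)).
  have /(subsetP sAB) : e \in val x :|: \bigcup_(y in A) val (val y).
    rewrite inE; apply/orP; right; apply/bigcupP; exists y => //.
    by rewrite yE !inE eqxx.
  rewrite inE (negPf enx) => /bigcupP[y' y'B].
  have [e' e'nx y'E] := feasible_coveredP (covY _ (valP y')).
  rewrite y'E !inE (negPf enx) orbF => /eqP ee'.
  by rewrite (_ : y = y') //; do 2!apply: val_inj; rewrite yE y'E ee'.
split=> [/andP[xz zxY]|[A <-]].
  exists [set y : T | (val y <= z)%O]; apply/val_inj; rewrite valg.
  apply/eqP; rewrite eqEsubset subUset -andbA.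
  apply/and3P; split=> //; first by apply/bigcupsP=> y; rewrite inE.
  apply/subsetP=> e ez; have := subsetP zxY e ez.
  rewrite val_feasible_join val_feasible_bigjoin !inE.
  case/orP=> [->//|/bigcupP[y yY ey]]; have [//|enx /=] := boolP (e \in val x).
  apply/bigcupP; exists (exist _ y yY : T) => //; rewrite inE.
  have [e' e'nx yE] := feasible_coveredP (covY _ yY).
  rewrite feasible_leE /= yE subUset -feasible_leE xz sub1set.
  by move: ey; rewrite yE !inE (negPf enx) orbF andbT => /eqP <-.
rewrite leUl; apply: leU2 => //; apply/joinsP=> y _.
exact: joins_sup (valP y).
Qed.

Lemma feasible_graded (rk : L -> nat) :
  (forall x, rk x = #|val x|) -> graded_by rk.
Proof.
move=> rkE; split; first by rewrite rkE cards0.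
move=> x y /feasible_coveredP[e enx yE].
by rewrite !rkE yE cardsU1 enx.
Qed.

Lemma feasible_supersolvable : supersolvable L.
Proof.
pose T : L := \top%O.
pose M := [set z : L | [exists k : 'I_m.+1, val z == below (val T) k]].
have MP k : k < m.+1 -> exists2 z : L, z \in M & val z = below (val T) k.
  move=> km; exists (feasible_of (feasible_below k (valP T))) => //.
  by rewrite inE; apply/existsP; exists (Ordinal km).
exists M.
  have below_mono k l : k <= l -> below (val T) k \subset below (val T) l.
    move=> kl; apply/subsetP=> i; rewrite !inE => /andP[-> ik].
    exact: leq_trans kl.
  apply/maxsetP; split.
    apply/forall_inP=> x; rewrite inE => /existsP[k /eqP xk].
    apply/forall_inP=> y; rewrite inE => /existsP[l /eqP yl].
    apply/orP; rewrite !feasible_leE.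
    by rewrite xk yl; have /orP[kl|lk] := leq_total k l; [left|right];
       apply: below_mono.
  move=> X chX sMX; apply/eqP; rewrite eqEsubset sMX andbT.
  apply/subsetP=> z zX; rewrite inE.
  have cmpz k : k < m.+1 ->
      (val z \subset below (val T) k) || (below (val T) k \subset val z).
    move=> /MP[t tM <-].
    by have := forall_inP (forall_inP chX z zX) t (subsetP sMX t tM).
  have ex0 : below (val T) (@ord0 m) \subset val z.
    by apply/subsetP=> i; rewrite !inE andbF.
  (* Take the largest [k] whose truncation of [T] lies in [z]. If [k < m], then [z] is comparable
     with the next truncation, hence lies in it, and misses the one element by which the two
     truncations differ. *)
  case: (@arg_maxnP _ ord0 (fun k : 'I_m.+1 => below (val T) k \subset val z)
    (@nat_of_ord m.+1) ex0) => k kz kmax.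
  apply/existsP; exists k; rewrite eqEsubset kz andbT.
  have sT : val z \subset val T := lex1 z.
  have [kEm|k'm] := eqVneq (nat_of_ord k) m.
    by apply/subsetP=> i iz; rewrite inE kEm ltn_ord (subsetP sT).
  have km : k < m by rewrite ltn_neqAle k'm -ltnS ltn_ord.
  have nsub : ~~ (below (val T) k.+1 \subset val z).
    apply/negP=> sk; have := kmax (Ordinal (km : k.+1 < m.+1)) sk.
    by rewrite /= ltnn.
  have := cmpz k.+1 km; rewrite (negPf nsub) orbF => szk.
  have [i] := subsetPn nsub; rewrite !inE ltnS => /andP[iT ik] inz.
  have iE : k = i :> nat.
    apply/eqP; rewrite eqn_leq ik andbT leqNgt.
    by apply: contra inz => ltik; apply: (subsetP kz); rewrite inE iT.
  apply/subsetP=> j jz; have := subsetP szk j jz.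
  rewrite !inE ltnS leq_eqVlt iE => /andP[-> /orP[|//]].
  by rewrite val_eqE => /eqP ji; rewrite -ji jz in inz.
move=> X /maxsetP[chX _].
pose Q (Y : L) := (Y == T) || (Y \in X).
(* [G] singles out the unions of sets [below Y k] with [Y] in [X] or [Y = T]. *)
pose G (z : L) := forall e, e \in val z ->
  exists Y, [/\ Q Y, e \in val Y & below (val Y) e.+1 \subset val z].
have cmpQ Y Z : Q Y -> Q Z -> (Y <= Z)%O || (Z <= Y)%O.
  rewrite /Q => /predU1P[->|YX] /predU1P[->|ZX]; rewrite ?lex1 ?orbT //.
  exact: (forall_inP (forall_inP chX Y YX) Z ZX).
have GU x y : G x -> G y -> G (x `|` y)%O.
  move=> Gx Gy e; rewrite inE => /orP[/Gx|/Gy] [Y [QY eY sY]]; exists Y.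
    by split=> //; apply: subset_trans (subsetUl _ _).
  by split=> //; apply: subset_trans (subsetUr _ _).
have GI x y e : G x -> G y -> e \in val x :&: val y ->
    exists Y,
      [/\ Q Y, e \in val Y & below (val Y) e.+1 \subset val x :&: val y].
  move=> Gx Gy; rewrite inE => /andP[/Gx[Y [QY eY sY]] /Gy[Z [QZ eZ sZ]]].
  have belowS (U V : L) : (U <= V)%O ->
      below (val U) e.+1 \subset below (val V) e.+1.
    move=> /subsetP UV; apply/subsetP=> i; rewrite !inE => /andP[iU ->].
    by rewrite UV.
  (* The smaller of the comparable sets [Y] and [Z] has the smaller truncation, which therefore lies
     in both [x] and [y]. *)
  have /orP[YZ|ZY] := cmpQ Y Z QY QZ; [exists Y | exists Z]; split=> //.
    by rewrite subsetI sY (subset_trans (belowS _ _ YZ)).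
  by rewrite subsetI sZ (subset_trans (belowS _ _ ZY)).
have valI x y : G x -> G y -> val (x `&` y)%O = val x :&: val y.
  move=> Gx Gy; apply: val_feasible_meet.
  (* By [GI] the intersection is the union of the truncations that it contains, and is therefore
     feasible. *)
  rewrite (_ : _ :&: _ =
      \bigcup_(Ye : L * 'I_m | below (val Ye.1) Ye.2.+1 \subset val x :&: val y)
         below (val Ye.1) Ye.2.+1).
    by apply: feasible_bigcup => Ye _; apply/feasible_below/valP.
  apply/eqP; rewrite eqEsubset andbC; apply/andP; split.
    by apply/bigcupsP.
  apply/subsetP=> e exy; have [Y [QY eY sY]] := GI x y e Gx Gy exy.
  by apply/bigcupP; exists (Y, e) => //=; rewrite inE eY /=.
have GI' x y : G x -> G y -> G (x `&` y)%O.
  by move=> Gx Gy e; rewrite valI //; apply: GI.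
have genG z : in_generated_sublattice (M :|: X) z -> G z.
  move=> /(_ [set z | `[< G z >]]) gen.
  suff: z \in [set z | `[< G z >]] by rewrite inE => /asboolP.
  apply: gen => [|x y|x y]; rewrite ?inE.
  - apply/subsetP=> x; rewrite !inE => /orP[/existsP[k /eqP xk]|xX];
      apply/asboolP => e ex.
      exists T; split; first by rewrite /Q eqxx.
        by move: ex; rewrite xk inE => /andP[].
      apply/subsetP=> i; rewrite xk !inE => /andP[-> ie].
      by move: ex; rewrite xk inE => /andP[_]; apply: leq_ltn_trans.
    exists x; split=> //; first by rewrite /Q xX orbT.
    by apply/subsetP=> i; rewrite inE => /andP[].
  - by move=> /asboolP Gx /asboolP Gy; apply/asboolP/GI'.
  - by move=> /asboolP Gx /asboolP Gy; apply/asboolP/GU.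
move=> x y z /genG Gx /genG Gy /genG Gz; apply: val_inj.
by rewrite val_feasible_join !valI ?val_feasible_join ?setIUr //; apply: GU.
Qed.

End Antimatroid.

(** * Inversions and the strong exchange property of Coxeter groups *)

Section Reflections.
Variables (W : groupType) (S : Type) (C : coxeter_system W S).
Implicit Types (a b : seq S) (r w x y : W) (s : S).
Local Open Scope group_scope.

Local Notation prodw := (word_prod C).
Local Notation len := (cox_length C).

Lemma word_prod_cat a b : prodw (a ++ b) = prodw a * prodw b.
Proof. exact: big_cat. Qed.

Lemma word_prod_cons s a : prodw (s :: a) = C s * prodw a.
Proof. exact: big_cons. Qed.

Lemma word_prod_nil : prodw [::] = 1.
Proof. exact: big_nil. Qed.

Lemma cox_genV s : (C s)^-1 = C s.
Proof. by apply: (mulgI (C s)); rewrite mulgV cox_gen_invol. Qed.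

Lemma cox_genK s w : C s * (C s * w) = w.
Proof. by rewrite mulgA cox_gen_invol mul1g. Qed.

Lemma signed_eval_word_prod (a : signed_word S) :
  signed_eval C a = prodw (map fst a).
Proof.
rewrite /word_prod /signed_eval big_map; apply: eq_bigr => -[s []] //= _.
exact: cox_genV.
Qed.

(* The parity of the number of i with
   r = a_1 .. a_(i-1) a_i a_(i-1) .. a_1. *)
Fixpoint crossings a r : bool :=
  if a is s :: a' then (r == C s) (+) crossings a' (r ^ C s) else false.

Lemma crossings_cat a b r :
  crossings (a ++ b) r = crossings a r (+) crossings b (r ^ prodw a).
Proof.
elim: a r => [|s a IHa] r /=; first by rewrite word_prod_nil conjg1.
by rewrite IHa word_prod_cons conjgM addbA.
Qed.

Definition alternating (s t : S) n : seq S := flatten (nseq n [:: s; t]).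

Lemma prod_alternating s t n : prodw (alternating s t n) = (C s * C t) ^+ n.
Proof.
elim: n => [|n IHn]; first by rewrite word_prod_nil.
by rewrite !word_prod_cons IHn expgS mulgA.
Qed.

Lemma crossings_alternating s t n r :
  crossings (alternating s t n) r =
    \big[addb/false]_(i < n.*2) (r == (C s * C t) ^+ i * C s).
Proof.
elim: n r => [|n IHn] r; first by rewrite big_ord0.
rewrite /= {}IHn doubleS !big_ord_recl /= mul1g expg1; congr (_ (+) (_ (+) _)).
  by rewrite (can2_eq (conjgK _) (conjgKV _)) conjgE invgK cox_genV mulgA.
apply: eq_bigr => i _; rewrite -conjgM (can2_eq (conjgK _) (conjgKV _)).
by rewrite conjgE invgK invgM !cox_genV /bump /= !add1n expgSr expgS !mulgA.
Qed.

(** A cancelled pair of letters counts the same reflection twice. A relator counts the elements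
    [(s t)^i s] for [i < 2 m(s,t)]; since [(s t)^m(s,t) = 1], the two halves of this range give the
    same elements, and the parity is even. *)
Lemma crossings_presented_eq (a b : signed_word S) :
    presented_eq (coxeter_relator (cox_mat C)) a b ->
  forall r, crossings (map fst a) r = crossings (map fst b) r.
Proof.
elim=> {a b} [//|a b _ IH r|b a c _ IH1 _ IH2 r|a b s e r|a b q [s [t qE]] r].
- by rewrite IH.
- by rewrite IH1.
- rewrite !map_cat !crossings_cat; congr (_ (+) _) => /=.
  set r' := r ^ _.
  rewrite word_prod_cons word_prod_cons word_prod_nil mulg1.
  rewrite cox_gen_invol conjg1.
  have -> : (r' ^ C s == C s) = (r' == C s).
    by rewrite (can2_eq (conjgK _) (conjgKV _)) conjgE invgK mulgV mulg1.
  by rewrite addKb.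
have qE' : map fst q = alternating s t (cox_mat C s t).
  by rewrite qE map_flatten map_nseq.
have st1 : (C s * C t) ^+ cox_mat C s t = 1.
  rewrite -prod_alternating -qE' -signed_eval_word_prod -word_prod_nil.
  rewrite -(signed_eval_word_prod [::]); apply/(proj2 (cox_presentation C)).
  rewrite -[q in presented_eq _ q _]cats0 -[q ++ _]cat0s.
  by apply: presented_relator; exists s, t.
rewrite !map_cat !crossings_cat; congr (_ (+) _).
rewrite qE' prod_alternating st1 conjg1 crossings_alternating.
rewrite -[RHS]addFb; congr (_ (+) _); rewrite -addnn big_split_ord /=.
under [X in _ (+) X]eq_bigr do rewrite expgnDr st1 mul1g.
by rewrite addbb.
Qed.

Lemma crossings_word_prod a b r :
  prodw a = prodw b -> crossings a r = crossings b r.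
Proof.
pose sg := map (fun s : S => (s, false)).
have sgK c : map fst (sg c) = c by rewrite -map_comp map_id.
rewrite -{1}[a]sgK -{1}[b]sgK -!signed_eval_word_prod => e.
rewrite -[a]sgK -[b]sgK; apply: crossings_presented_eq.
by apply/(proj2 (cox_presentation C)).
Qed.

(* Left inversions: for a reflection r this says that r w is shorter than w. *)
Definition inversion w r : bool :=
  `[< exists2 a, prodw a = w & crossings a r >].

Lemma inversionE a r : inversion (prodw a) r = crossings a r.
Proof.
apply/asboolP/idP => [[b /crossings_word_prod <-] //|ar].
by exists a.
Qed.

Lemma word_of w : exists a, prodw a = w.
Proof. by have [n /asboolP[a aw _]] := word_prod_onto C w; exists a. Qed.

Lemma len_min a : len (prodw a) <= size a.
Proof.
rewrite /cox_length; case: ex_minnP => n _; apply.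
by apply/asboolP; exists a.
Qed.

Lemma reduced_word w : exists2 a, prodw a = w & size a = len w.
Proof. by rewrite /cox_length; case: ex_minnP => n /asboolP. Qed.

Lemma len1 : len 1 = 0.
Proof. by apply/eqP; rewrite -leqn0 -word_prod_nil len_min. Qed.

Lemma len_mul x y : len (x * y) <= len x + len y.
Proof.
have [a <- <-] := reduced_word x; have [b <- <-] := reduced_word y.
by rewrite -word_prod_cat -size_cat len_min.
Qed.

Lemma len_gen s : len (C s) <= 1.
Proof.
rewrite -[C s]mulg1 -word_prod_nil -word_prod_cons; exact: (len_min [:: s]).
Qed.

Lemma inversionM x y r :
  inversion (x * y) r = inversion x r (+) inversion y (r ^ x).
Proof.
have [a <-] := word_of x; have [b <-] := word_of y.
by rewrite -word_prod_cat !inversionE crossings_cat.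
Qed.

Lemma inversion1 r : inversion 1 r = false.
Proof. by rewrite -word_prod_nil inversionE. Qed.

Lemma inversion_gen s r : inversion (C s) r = (r == C s).
Proof.
rewrite -[C s]mulg1 -word_prod_nil -word_prod_cons inversionE /= addbF.
by rewrite word_prod_cons word_prod_nil mulg1.
Qed.

(** An odd count is nonzero, so [r] is [a_1 .. a_i .. a_1] for some [i], and left multiplication by
    it deletes the letter [a_i]. *)
Lemma strong_exchange a r : crossings a r ->
  exists b s c, a = b ++ s :: c /\ r * prodw a = prodw (b ++ c).
Proof.
elim: a r => [//|s a IHa] r /=.
have [-> _|_ /= /IHa[b [t [c [-> e]]]]] := eqVneq r (C s).
  by exists [::], s, a; rewrite word_prod_cons cox_genK.
exists (s :: b), t, c; split=> //=.
rewrite [RHS]word_prod_cons -e word_prod_cons conjgE cox_genV.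
by rewrite !mulgA cox_gen_invol mul1g.
Qed.

Lemma inversion_len w r : inversion w r -> len (r * w) < len w.
Proof.
have [a <- sa] := reduced_word w; rewrite inversionE => /strong_exchange.
move=> [b [s [c [aE ->]]]]; rewrite -sa aE.
by apply: leq_ltn_trans (len_min _) _; rewrite !size_cat /= addnS.
Qed.

Lemma inversion_genM s w : inversion (C s * w) (C s) = ~~ inversion w (C s).
Proof.
by rewrite inversionM inversion_gen eqxx conjgE mulgA mulVg mul1g.
Qed.

(** Multiplication by [C s] toggles the inversion [C s], so exactly one of [w] and [C s * w] has it,
    and that one is the longer. *)
Lemma inversion_genP s w : inversion w (C s) = (len (C s * w) < len w).
Proof.
apply/idP/idP; first exact: inversion_len.
apply: contraTT; rewrite -inversion_genM => /inversion_len.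
by rewrite cox_genK -leqNgt => /ltnW.
Qed.

Lemma len_genM s w : ~~ inversion w (C s) -> len (C s * w) = (len w).+1.
Proof.
rewrite -inversion_genM => /inversion_len; rewrite cox_genK => lt.
apply/eqP; rewrite eqn_leq lt andbT; apply: leq_trans (len_mul _ _) _.
by rewrite -add1n leq_add2r len_gen.
Qed.

Lemma inversion_prefix x y s :
  len (x * y) = len x + len y -> inversion x (C s) -> inversion (x * y) (C s).
Proof.
move=> lxy; rewrite !inversion_genP lxy mulgA => lt.
by apply: leq_ltn_trans (len_mul _ _) _; rewrite ltn_add2r.
Qed.

(* The lifting property along a Bruhat cover: with w = p c t and z = p t, the
   conclusion says z = s w. *)
Lemma insertion_lifting (s c : S) (p t : W) :
    len (p * C c * t) = (len p + len t).+1 ->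
    len (p * t) = len p + len t ->
    inversion (p * C c * t) (C s) -> ~~ inversion (p * t) (C s) ->
  C s * (p * C c) = p.
Proof.
move=> lw lz ws zs; pose r := C c ^ p^-1.
have rw : r * (p * C c * t) = p * t.
  by rewrite /r conjgE invgK !mulgA mulgVK -!mulgA cox_genK.
(* By [inversionM] the parity is the sum of contributions of [p], [C c] and [t]. The outer two
   vanish, as otherwise [p * C c] or [C c * t] would be too short for the length of
   [p * C c * t]. *)
have wr : inversion (p * C c * t) r.
  have rp : r ^ p = C c by rewrite /r conjgKV.
  rewrite -mulgA inversionM rp inversionM inversion_gen eqxx.
  rewrite [C c ^ C c]conjgE mulKg.
  have -> : inversion p r = false.
    apply/negP=> /inversion_len; rewrite /r conjgE invgK -!mulgA mulVg mulg1.
    rewrite ltnNge => /negP; apply.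
    have := len_mul (p * C c) t; rewrite lw -addSn leq_add2r.
    exact: ltnW.
  suff -> : inversion t (C c) = false by [].
  apply/negP=> /inversion_len; rewrite ltnNge => /negP; apply.
  have := len_mul p (C c * t); rewrite mulgA lw -addnS leq_add2l.
  exact: ltnW.
have [b bE sb] := reduced_word (C s * (p * C c * t)).
have lsw := inversion_len ws.
have wE : prodw (s :: b) = p * C c * t by rewrite word_prod_cons bE cox_genK.
(* Strong exchange deletes one letter of [s :: b]. If it is the leading [s], then [z = s w], as
   wanted. If it lies in [b], then [s z] has length at most [len w - 2], which makes [s] a descent
   of [z]. *)
move: wr; rewrite -wE inversionE => /strong_exchange[d [u [e [dE]]]].
rewrite wE rw; case: d dE => [[_ <-]|v d [<- bE']] /=.
  by rewrite bE !mulgA => /mulIg/esym.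
rewrite word_prod_cons => ptE; case/negP: zs.
rewrite inversion_genP {1}ptE cox_genK lz -ltnS -lw.
apply: leq_trans lsw; rewrite ltnS -sb bE' size_cat /= addnS -size_cat.
exact: len_min.
Qed.

End Reflections.

(** * Sorted index sets and their exchange axiom *)

Definition above (m : nat) (A : {set 'I_m}) (k : nat) : {set 'I_m} :=
  [set i in A | k < i].

Lemma set_min_ind (m : nat) (P : {set 'I_m} -> Prop) :
    P set0 ->
    (forall (i : 'I_m) (A : {set 'I_m}),
       (forall k : 'I_m, k \in A -> i < k) -> P A -> P (i |: A)) ->
  forall A, P A.
Proof.
move=> P0 PU A; have [n] := ubnP #|A|; elim: n A => // n IHn A.
have [->//|[i iA]] := set_0Vmem A; rewrite ltnS => leAn.
have [x xA xmin] := set_has_min iA.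
rewrite -(setD1K xA); apply: PU => [k|].
  by rewrite !inE ltn_neqAle eq_sym => /andP[-> /xmin].
by apply: IHn; apply: leq_trans leAn; rewrite [leqRHS](cardsD1 x) xA.
Qed.

Section SortedSets.
Variables (W : groupType) (S : Type) (C : coxeter_system W S).
Variables (m : nat) (omega : m.-tuple S).
Implicit Types (A B D : {set 'I_m}) (i j k x y : 'I_m).
Local Open Scope group_scope.

Local Notation len := (cox_length C).
Local Notation letter i := (C (tnth omega i)).
Local Notation sprod A := (word_prod C (subword omega A)).

Lemma subwordU A B : (forall i j, i \in A -> j \in B -> i < j) ->
  subword omega (A :|: B) = subword omega A ++ subword omega B.
Proof.
move=> ltAB; rewrite /subword -map_cat; congr map.
pose lt := relpre (@nat_of_ord m) ltn.
have lt_tr : transitive lt by move=> ? ? ?; apply: ltn_trans.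
have lt_enum D : pairwise lt (enum D).
  rewrite -(sorted_pairwise lt_tr) {1}/enum_mem; apply: sorted_filter => //.
  by rewrite -sorted_map -enumT val_enum_ord iota_ltn_sorted.
apply: (irr_sorted_eq lt_tr) => [i||| i]; rewrite ?sorted_pairwise //.
- exact: ltnn.
- rewrite pairwise_cat !lt_enum !andbT; apply/allrelP=> i j.
  by rewrite !mem_enum; apply: ltAB.
- by rewrite mem_cat !mem_enum inE.
Qed.

Lemma sprodU A B : (forall i j, i \in A -> j \in B -> i < j) ->
  sprod (A :|: B) = sprod A * sprod B.
Proof. by move=> /subwordU->; rewrite word_prod_cat. Qed.

Lemma sprod0 : sprod set0 = 1.
Proof. by rewrite /subword enum_set0 word_prod_nil. Qed.

Lemma sprod_set1 i : sprod [set i] = letter i.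
Proof. by rewrite /subword enum_set1 /= word_prod_cons word_prod_nil mulg1. Qed.

Lemma sprodU1 i A : (forall k, k \in A -> i < k) ->
  sprod (i |: A) = letter i * sprod A.
Proof.
by move=> ltA; rewrite sprodU ?sprod_set1 // => j k /set1P-> /ltA.
Qed.

Lemma size_subword A : size (subword omega A) = #|A|.
Proof. by rewrite size_map cardE. Qed.

Lemma len_sprod_le A : len (sprod A) <= #|A|.
Proof. by rewrite -size_subword len_min. Qed.

Lemma split_notin A j : j \notin A -> A = below A j :|: above A j.
Proof.
move=> jA; apply/setP=> i; rewrite !inE -andb_orr -neq_ltn.
by have [/val_inj->|_] := eqVneq (val i) (val j); rewrite ?(negPf jA) ?andbT.
Qed.

Lemma split_in A j : j \in A -> A = below A j :|: (j |: above A j).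
Proof.
move=> jA; apply/setP=> i; rewrite !inE orbCA -andb_orr -neq_ltn.
have [->|ij] := eqVneq i j; first by rewrite jA.
by rewrite val_eqE ij andbT.
Qed.

Lemma sprod_split_notin A j : j \notin A ->
  sprod A = sprod (below A j) * sprod (above A j).
Proof.
move=> /split_notin {1}->; apply: sprodU => i k; rewrite !inE.
by move=> /andP[_ ij] /andP[_]; apply: ltn_trans.
Qed.

Lemma sprod_split_in A j : j \in A ->
  sprod A = sprod (below A j) * (letter j * sprod (above A j)).
Proof.
move=> /split_in {1}->; rewrite sprodU ?sprodU1 // => [k|i k]; rewrite !inE.
  by case/andP.
by move=> /andP[_ ij] /predU1P[->//|/andP[_]]; apply: ltn_trans.
Qed.

Lemma above_U1 i A : (forall k, k \in A -> i < k) -> above (i |: A) i = A.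
Proof.
move=> ltA; apply/setP=> k; rewrite !inE.
by have [->|ki] := eqVneq k i; [rewrite ltnn andbF; apply/esym/negP=> /ltA|];
   rewrite ?ltnn //=; apply/andP/idP => [[]|kA] //; split=> //; apply: ltA.
Qed.

Lemma aboveU A B k : above (A :|: B) k = above A k :|: above B k.
Proof. by apply/setP=> i; rewrite !inE andb_orl. Qed.

Lemma above1 (i k : 'I_m) : above [set i] k = if k < i then [set i] else set0.
Proof.
apply/setP=> j; rewrite !inE; case: ifP => ki; rewrite !inE.
  by case: eqP => //= ->.
by case: eqP => //= ->.
Qed.

Lemma above_above A (k l : nat) : k <= l -> above (above A k) l = above A l.
Proof.
move=> kl; apply/setP=> i; rewrite !inE -andbA; congr (_ && _).
by case: (ltnP l i) => li; rewrite ?andbF ?andbT // (leq_ltn_trans kl).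
Qed.

(** The argument of [strong_exchange], repeated on index sets to record which index is deleted. *)
Lemma set_exchange A (r : W) : inversion C (sprod A) r ->
  exists2 i, i \in A & r * sprod A = sprod (A :\ i).
Proof.
elim/set_min_ind: A r => [r|i A ltA IHA r]; first by rewrite sprod0 inversion1.
have iA : i \notin A by apply/negP=> /ltA; rewrite ltnn.
rewrite sprodU1 // inversionM inversion_gen.
have [-> _|_ /= /IHA[k kA e]] := eqVneq r (letter i).
  by exists i; rewrite ?setU11 // cox_genK setU1K.
have ltik := ltA k kA.
exists k; first by rewrite !inE kA orbT.
rewrite setDUl (setDidPl _) ?disjoints1 ?inE; last first.
  by rewrite -val_eqE /= neq_ltn ltik.
rewrite sprodU1 => [|l /setD1P[_ /ltA]//].
by rewrite -e conjgE cox_genV !mulgA cox_gen_invol mul1g.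
Qed.

(* [A] indexes a reduced word if the same holds with [j] ranging over [A]; that
   it also holds for [j] outside [A] says that no letter can be moved to the
   left, that is, that [A] is lexicographically first. *)
Definition sorted_set A : bool :=
  [forall j : 'I_m, ~~ inversion C (sprod (above A j)) (letter j)].

Lemma len_sprod A :
    (forall j, j \in A -> ~~ inversion C (sprod (above A j)) (letter j)) ->
  len (sprod A) = #|A|.
Proof.
elim/set_min_ind: A => [_|i A ltA IHA invA].
  by rewrite sprod0 len1 cards0.
have iA : i \notin A by apply/negP=> /ltA; rewrite ltnn.
rewrite sprodU1 // cardsU1 iA len_genM.
  rewrite IHA // => j jA; have := invA j; rewrite !inE jA orbT => /(_ isT).
  by rewrite aboveU above1 ltnNge ltnW ?ltA // set0U.
by have := invA i; rewrite above_U1 // setU11; apply.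
Qed.

Lemma len_sprod_sorted A : sorted_set A -> len (sprod A) = #|A|.
Proof. by move=> /forallP sA; apply: len_sprod. Qed.

Lemma card_lt_setU A B : (forall i j, i \in A -> j \in B -> i < j) ->
  #|A :|: B| = #|A| + #|B|.
Proof. by move=> /subwordU e; rewrite -!size_subword e size_cat. Qed.

Lemma reducedU A B : (forall i j, i \in A -> j \in B -> i < j) ->
    len (sprod (A :|: B)) = #|A :|: B| ->
  len (sprod A) = #|A| /\ len (sprod B) = #|B|.
Proof.
move=> ltAB; rewrite sprodU // card_lt_setU // => lAB.
have lif := leqif_add (leqif_eq (len_sprod_le A)) (leqif_eq (len_sprod_le B)).
have : len (sprod A) + len (sprod B) == #|A| + #|B|.
  by rewrite eqn_leq lif -lAB len_mul.
by rewrite lif => /andP[/eqP-> /eqP->].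
Qed.

Lemma reduced_inversion A j : len (sprod A) = #|A| -> j \in A ->
  ~~ inversion C (sprod (above A j)) (letter j).
Proof.
move=> lA jA; rewrite inversion_genP -leqNgt.
have ltj k : k \in above A j -> j < k by rewrite inE => /andP[].
have ltU i k : i \in below A j -> k \in j |: above A j -> i < k.
  rewrite !inE => /andP[_ ij] /predU1P[->//|/andP[_]].
  exact: ltn_trans.
have [|_] := reducedU ltU; first by rewrite -split_in.
rewrite sprodU1 // cardsU1 inE ltnn andbF add1n => ->.
exact: leq_trans (len_sprod_le _) (leqnSn _).
Qed.

Lemma lex_le_anti A B : lex_le A B -> lex_le B A -> A = B.
Proof.
rewrite /lex_le eq_sym; case: eqVneq => //= _.
move=> /exists_inP[i iD /andP[/forall_inP imin iA]].
move=> /exists_inP[j jD /andP[/forall_inP jmin jB]].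
have jD' : j \in (A :|: B) :\: (A :&: B) by rewrite setUC setIC.
have iD' : i \in (B :|: A) :\: (B :&: A) by rewrite setUC setIC.
have ij : i = j by apply/val_inj/eqP; rewrite eqn_leq imin // jmin.
by move: iD; rewrite !inE iA ij jB.
Qed.

(** Suppose that the first index [x] where the sets differ lies in [B]. Cancelling the common part
    before [x] makes the letter of [x] a left descent of the product of [above A x], against the
    criterion for [A] at the outside index [x]. *)
Lemma sorted_lex_le A B : sorted_set A -> len (sprod B) = #|B| ->
  sprod B = sprod A -> lex_le A B.
Proof.
move=> /forallP sA lB eBA; rewrite /lex_le; case: eqVneq => //= neqAB.
set D := (A :|: B) :\: (A :&: B).
have [i iD] : exists i, i \in D.
  apply/set0Pn; apply: contra neqAB => /eqP D0; apply/eqP/setP=> i.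
  by have /setP/(_ i) := D0; rewrite !inE; case: (i \in A) (i \in B) => [] [].
have [x xD xmin] := set_has_min iD.
apply/exists_inP; exists x => //; apply/andP; split; first exact/forall_inP.
apply/negPn/negP=> xA; have xB : x \in B.
  by move: xD; rewrite !inE (negPf xA).
have below_eq : below A x = below B x.
  apply/setP=> k; rewrite !inE.
  case: (ltnP k x) => [kx|]; rewrite ?andbF ?andbT //.
  apply/idP/idP => kAB; apply/negPn/negP=> kBA;
    by have := xmin k; rewrite !inE kAB (negPf kBA) leqNgt kx => /(_ isT).
case/negP: (sA x); move: eBA.
rewrite (sprod_split_notin xA) (sprod_split_in xB) below_eq.
move=> /mulgI <-; rewrite inversion_genM.
exact: reduced_inversion.
Qed.

Lemma sort_word_sorted A : sorted_set A -> sort_word C omega (sprod A) = A.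
Proof.
move=> sA; have lA := len_sprod_sorted sA.
have redE B : reduced_subword_for C omega (sprod A) B =
    (len (sprod B) == #|B|) && (sprod B == sprod A).
  by rewrite /reduced_subword_for /reduced size_subword eq_sym.
have redA : reduced_subword_for C omega (sprod A) A by rewrite redE lA !eqxx.
have minA B : reduced_subword_for C omega (sprod A) B -> lex_le A B.
  by rewrite redE => /andP[/eqP lB /eqP]; apply: sorted_lex_le.
rewrite /sort_word; case: pickP => [B /andP[redB /forallP minB]|/(_ A)] /=.
  apply: lex_le_anti; last exact: minA.
  exact: (implyP (minB A)).
by rewrite redA => /negP[]; apply/forallP=> B; apply/implyP/minA.
Qed.

(** An index set of least weight with the given product is sorted. If the criterion failed at [j],
    exchange would yield an [i > j] such that [i] and [j] can both be deleted, when [j] is in the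
    set, or [i] can be replaced by [j], when it is not; either change lowers the weight. *)
Lemma exists_sorted A : exists2 B, sorted_set B & sprod B = sprod A.
Proof.
pose weight B := \sum_(i in B) i.+1.
have AA : sprod A == sprod A by [].
case: (@arg_minnP _ A (fun B => sprod B == sprod A) weight AA).
move=> B /eqP <- Bmin.
exists B => //; apply/forallP=> j; apply/negP=> /set_exchange[i].
rewrite inE => /andP[iB ji] e.
have jNi : j != i by rewrite -val_eqE /= neq_ltn ji.
have [jB|jB] := boolP (j \in B).
  have /eqP/Bmin : sprod (B :\ j :\ i) = sprod B.
    rewrite [RHS](sprod_split_in jB) e -sprodU.
      congr (sprod _); rewrite [in LHS](split_in jB).
      apply/setP=> k; rewrite !inE.
      have [->|kj] := eqVneq k j; first by rewrite ltnn !andbF.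
      have [->|//] := eqVneq k i.
      by rewrite ltnNge ltnW //= andbF.
    move=> k l; rewrite !inE => /andP[_ kj] /and3P[_ _].
    exact: ltn_trans.
  rewrite /weight [leqLHS](big_setD1 j jB) [X in _ + X <= _](big_setD1 i) /=.
    by rewrite leqNgt addSn ltnS addnA leq_addl.
  by rewrite !inE eq_sym jNi.
have /eqP/Bmin : sprod (j |: (B :\ i)) = sprod B.
  rewrite [RHS](sprod_split_notin jB).
  rewrite -[sprod (above B j)](cox_genK C (tnth omega j)) e -sprodU1.
    rewrite -sprodU; first congr (sprod _).
      rewrite [in LHS](split_notin jB).
      apply/setP=> k; rewrite !inE.
      have [->|kj] := eqVneq k j; first by rewrite orbT.
      have [->|//] := eqVneq k i.
      by rewrite ltnNge ltnW //= andbF.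
    move=> k l; rewrite !inE => /andP[_ kj] /predU1P[->//|/and3P[_ _]].
    exact: ltn_trans.
  by move=> k; rewrite !inE => /and3P[].
rewrite /weight [leqLHS](big_setD1 i iB) big_setU1 /=.
  by rewrite leq_add2r ltnS leqNgt ji.
by rewrite !inE (negPf jB) andbF.
Qed.

(** For [j < k], the part of [A] to the right of [j] is reduced and has the truncated part as a
    prefix, so a left descent of that prefix would be one of the whole product. *)
Lemma sorted_below A (k : nat) : sorted_set A -> sorted_set (below A k).
Proof.
move=> sA; apply/forallP=> j; apply/negP.
have [kj|jk] := leqP k j.
  rewrite (_ : above _ _ = set0) ?sprod0 ?inversion1 //.
  apply/setP=> i; rewrite !inE; apply/negP=> /andP[/andP[_ ik]].
  by rewrite ltnNge ltnW // (leq_trans ik).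
pose B := [set i in A | k <= i].
have aE : above A j = above (below A k) j :|: B.
  apply/setP=> i; rewrite !inE -!andbA -andb_orr; congr (_ && _).
  by case: (ltnP i k) => ik; rewrite ?orbF //= (leq_trans jk).
have ltB i l : i \in above (below A k) j -> l \in B -> i < l.
  by rewrite !inE -!andbA => /and3P[_ ik _] /andP[_]; apply: leq_trans.
have red D : (forall j' : 'I_m, j' \in D -> above D j' = above A j') ->
    len (sprod D) = #|D|.
  by move=> DA; apply: len_sprod => j' /DA ->; apply: (forallP sA).
have laj : len (sprod (above A j)) = #|above A j|.
  by apply: red => i; rewrite inE => /andP[_ /ltnW]; apply: above_above.
have lB : len (sprod B) = #|B|.
  apply: red => i; rewrite inE => /andP[_ ki].
  apply/setP=> l; rewrite !inE -andbA; congr (_ && _).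
  case: (ltnP i l) => il; rewrite ?andbF ?andbT //.
  by rewrite ltnW // (leq_ltn_trans ki).
have lP : len (sprod (above (below A k) j)) = #|above (below A k) j|.
  by case: (@reducedU (above (below A k) j) B) => //; rewrite -aE.
move=> inv; case/negP: (forallP sA j); rewrite aE sprodU //.
apply: inversion_prefix => //.
by rewrite -sprodU // -aE laj aE card_lt_setU // lP lB.
Qed.

Lemma sorted_exchange A B x : sorted_set A -> sorted_set B ->
    x \in B :\: A -> (forall y, y \in B :\: A -> x <= y) ->
  sorted_set (x |: A).
Proof.
have [n] := ubnP x; elim: n x A B => // n IHn x A B.
rewrite ltnS => lexn sA sB /setDP[xB xA] xmin.
(* The elements of [B] before [x] lie in [A], so this set is [below B x.+1] enlarged by the missing
   elements of [below A x]. These are smaller than [x], and the outer induction adds them one at a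
   time. *)
have sA'' : sorted_set (x |: below A x).
  have -> : x |: below A x = below B x.+1 :|: below A x.
    apply/setP=> i; rewrite !inE ltnS.
    have [->|ix] := eqVneq i x; first by rewrite xB leqnn.
    rewrite [i <= x]leq_eqVlt (val_eqE i x) (negPf ix) /=.
    apply/idP/orP => [->|[/andP[iB ltix]|//]]; first by right.
    rewrite ltix andbT; apply/negPn/negP=> iA.
    by have := xmin i; rewrite inE iA iB leqNgt ltix => /(_ isT).
  apply: (@union_by_exchange _ sorted_set) => [|Y y sY _ yAY ymin].
    exact: sorted_below.
  have yx : y < n by move: yAY; rewrite !inE => /and3P[_ _ /leq_trans->].
  exact: (IHn y Y _ yx sY (sorted_below x sA) yAY ymin).
have invA j : ~~ inversion C (sprod (above A j)) (letter j) := forallP sA j.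
(* Descending induction on [j]: the criterion to the right of [j] makes [above (x |: A) j] reduced,
   which supplies a length required by [insertion_lifting]. *)
apply/forallP=> j; have [k] := ubnP (m - j); elim: k j => // k IHk j.
rewrite ltnS => lemj.
have IHj i : j < i -> ~~ inversion C (sprod (above (x |: A) i)) (letter i).
  by move=> ji; apply: IHk; apply: leq_trans lemj; apply: ltn_sub2l.
have [lexj|ltjx] := leqP x j.
  by rewrite aboveU above1 ltnNge lexj set0U.
pose P := above (below A x) j; pose T := above A x.
have ltP i l : i \in P -> l \in x |: T -> i < l.
  rewrite !inE => /andP[/andP[_ ix] _] /predU1P[->//|/andP[_]].
  exact: ltn_trans.
have ltPT i l : i \in P -> l \in T -> i < l.
  by move=> iP lT; apply: ltP => //; rewrite !inE in lT *; rewrite lT orbT.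
have ltT i : i \in T -> x < i by rewrite inE => /andP[].
have xT : x \notin T by rewrite inE ltnn andbF.
have AE : above A j = P :|: T.
  apply/setP=> i; rewrite !inE -andbA -andb_orr.
  have [->|ix] := eqVneq i x; first by rewrite (negPf xA).
  congr (_ && _); move: ix; rewrite neq_ltn => /orP[ix|xi].
    by rewrite ix (leq_gtF (ltnW ix)) orbF.
  by rewrite xi orbT (ltn_trans ltjx xi).
have ZE : above (x |: A) j = P :|: (x |: T).
  by rewrite aboveU above1 ltjx AE setUCA.
have lZ : len (sprod (above (x |: A) j)) = #|above (x |: A) j|.
  apply: len_sprod => i; rewrite inE => /andP[_ ji].
  by rewrite (above_above _ (ltnW ji)); apply: IHj.
have lA : len (sprod (above A j)) = #|above A j|.
  apply: len_sprod => i; rewrite inE => /andP[_ ji].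
  by rewrite (above_above _ (ltnW ji)).
have [lP lT] : len (sprod P) = #|P| /\ len (sprod T) = #|T|.
  by apply: reducedU => //; rewrite -AE.
have pctE : sprod (above (x |: A) j) = sprod P * letter x * sprod T.
  by rewrite ZE sprodU // sprodU1 // mulgA.
have lpct :
    len (sprod P * letter x * sprod T) = (len (sprod P) + len (sprod T)).+1.
  by rewrite -pctE lZ ZE card_lt_setU // cardsU1 xT lP lT addnA addn1 addSn.
have lpt : len (sprod P * sprod T) = len (sprod P) + len (sprod T).
  by rewrite -sprodU // -AE lA AE card_lt_setU // lP lT.
apply/negP; rewrite pctE => inv.
have := insertion_lifting lpct lpt inv; rewrite -sprodU // -AE => /(_ (invA j)).
have pcE : sprod (above (x |: below A x) j) = sprod P * letter x.
  rewrite aboveU above1 ltjx setUC sprodU ?sprod_set1 // => i l iP /set1P->.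
  by apply: ltP; rewrite ?setU11.
(* By [e], the letter of [j] takes [p s_x] to the shorter [p], so it is a left descent of the
   product of [above (x |: below A x) j]. *)
move=> e; case/negP: (forallP sA'' j); rewrite pcE inversion_genP e.
have := len_mul C (sprod P * letter x) (sprod T).
by rewrite lpct -addSn leq_add2r.
Qed.

Lemma sorted_set0 : sorted_set set0.
Proof.
apply/forallP=> j; rewrite (_ : above set0 j = set0) ?sprod0 ?inversion1 //.
by apply/setP=> i; rewrite !inE.
Qed.

Lemma sorted_sets0 : set0 \in [set A | sorted_set A].
Proof. by rewrite inE sorted_set0. Qed.

Lemma sorted_sets_exchange A B x :
    A \in [set A | sorted_set A] -> B \in [set A | sorted_set A] ->
    x \in B :\: A -> (forall y, y \in B :\: A -> x <= y) ->
  x |: A \in [set A | sorted_set A].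
Proof.
move=> + + xBA xmin; rewrite !inE => sA sB.
exact: (sorted_exchange sA sB).
Qed.

Definition sorted_sets : ss_antimatroid m :=
  SSAntimatroid sorted_sets0 sorted_sets_exchange.

End SortedSets.

Theorem corollary4p5 (W : groupType) (S : Type) (C : coxeter_system W S)
    (m : nat) (omega : m.-tuple S) :
  exists (d : Order.disp_t) (L : finTBLatticeType d)
         (f : L -> W_omega C omega),
    [/\ bijective f,
        forall x y : L,
          (x <= y)%O = sorting_le C omega (ssval (f x)) (ssval (f y)),
        join_distributive L,
        supersolvable L
      & graded_by (fun x : L => cox_length C (ssval (f x)))].
Proof.
pose L := feasible_lattice (sorted_sets C omega).
have sortedL (x : L) : sorted_set C omega (val x).
  by have := valP x; rewrite inE.
have in_prods A : word_prod C (subword omega A) \in subword_prods C omega.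
  by apply/imageP; exists A.
pose f (x : L) : W_omega C omega := SeqSub (in_prods (val x)).
have sort_f x : sort_word C omega (ssval (f x)) = val x.
  exact: sort_word_sorted.
exists (Order.Disp tt tt), L, f; split.
(* Surjectivity comes from [exists_sorted]; injectivity holds because [sort_word] recovers the index
   set from the product. *)
- have f_surj w : exists x, f x = w.
    case: w => w wP; have /imageP[A _ wA] := wP.
    have [B sB eBA] := exists_sorted C omega A.
    have BF : B \in sorted_sets C omega by rewrite inE.
    by exists (feasible_of BF); apply: val_inj; rewrite /= eBA.
  exists (fun w => sval (cid (f_surj w))) => x; last by case: cid.
  by apply: val_inj; case: cid => y e; rewrite -[LHS]sort_f e sort_f.
- by move=> x y; rewrite /sorting_le !sort_f.
- exact: feasible_join_distributive.
- exact: feasible_supersolvable.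
- by apply: feasible_graded => x; apply: len_sprod_sorted.
Qed.
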